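(* Let $p$ be a prime and let $G$ be a finitely generated free pro-$p$ group of rank $r>1$. Then $G$ is $\mathrm{Aut}_1$ but not $\mathrm{Aut}_2$.
   Context: For a profinite group $U$, $\mathrm{Aut}(U)$ is the group of continuous automorphisms, with the standard topology: a base of neighborhoods of $1$ is given by the sets $A(O)=\{\gamma\in\mathrm{Aut}(U):\gamma(g)\equiv g \bmod O \text{ for all } g\in U\}$, $O$ an open subgroup of $U$. $\mathrm{TAut}(U)$ is the subgroup of those automorphisms which fix pointwise some open subgroup of $U$. Commensurator of a profinite group $G$: a virtual automorphism of $G$ is a topological isomorphism between two open subgroups of $G$; two are equivalent if they coincide on some open subgroup; the equivalence classes form, under composition (after restricting to suitable open subgroups), a group $\mathrm{Comm}(G)$. For an open subgroup $U$ of $G$, the homomorphism $\rho_U:\mathrm{Aut}(U)\to\mathrm{Comm}(G)$ sends an automorphism to its class; its kernel is $\mathrm{TAut}(U)$, and its image $\underline{\mathrm{Aut}}(U)\cong\mathrm{Aut}(U)/\mathrm{TAut}(U)$ carries the quotient topology. $G$ is $\mathrm{Aut}_1$ if $\mathrm{TAut}(U)$ is closed in $\mathrm{Aut}(U)$ for every open subgroup $U$ of $G$. For open subgroups $V\subseteq U$ of $G$, let $\mathrm{Aut}(U)_V=\{\alpha\in\mathrm{Aut}(U):\alpha(V)=V\}$, and let $\underline{\mathrm{Aut}}(U)_V=\rho_U(\mathrm{Aut}(U)_V)\subseteq\underline{\mathrm{Aut}}(V)$. An open subgroup $U$ of $G$ is $\mathrm{Aut}$-stable if $\underline{\mathrm{Aut}}(U)_V$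 is open in $\underline{\mathrm{Aut}}(V)$ for every open subgroup $V$ of $U$. $G$ is $\mathrm{Aut}_2$ if $G$ is $\mathrm{Aut}_1$ and some open subgroup of $G$ is $\mathrm{Aut}$-stable. *)

(* Defs.v *)
From HB Require Import structures.
From mathcomp Require Import all_boot all_classical topology.

Set Implicit Arguments.
Unset Strict Implicit.
Unset Printing Implicit Defensive.

Local Open Scope classical_set_scope.
Local Open Scope group_scope.
Local Open Scope quotient_scope.

HB.structure Definition PreTopologicalGroup :=
  {G of Topological G & Group G}.

HB.mixin Record PreTopologicalGroup_isTopologicalGroup G
    of PreTopologicalGroup G := {
  mulg_continuous : continuous (fun x : G * G => x.1 * x.2);
  invg_continuous : continuous (fun x : G => x^-1)
}.

#[short(type="topGroupType")]
HB.structure Definition TopologicalGroup :=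
  {G of PreTopologicalGroup G & PreTopologicalGroup_isTopologicalGroup G}.

Record openSubgroup (G : topGroupType) := OpenSubgroup {
  subg_set :> set G;
  subg_open : open subg_set;
  subg1 : subg_set 1;
  subgM : forall x y, subg_set x -> subg_set y -> subg_set (x * y);
  subgV : forall x, subg_set x -> subg_set x^-1
}.

(* The carrier of an open subgroup [U] is [set_type U], which the library
   already endows with the subspace topology. *)
Section OpenSubgroupType.
Context (G : topGroupType) (U : openSubgroup G).

Fact subg_group_closed : group_closed (fun x : G => x \in (U : set G)).
Proof.
split=> [|x y]; rewrite !inE; first exact: subg1.
by move=> Ux Uy; apply: subgM => //; apply: subgV.
Qed.

HB.instance Definition _ :=
  [isSub of set_type U for @sval G (fun x => x \in (U : set G))].
HB.instance Definition _ := SubChoice_isSubGroup.Build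
  G (fun x : G => x \in (U : set G)) (set_type U) subg_group_closed.

Fact subg_val_continuous : continuous (val : U -> G).
Proof. exact: (@initial_continuous U G set_val). Qed.

Fact subg_mul_continuous : continuous (fun x : U * U => x.1 * x.2).
Proof.
apply: (@continuous_comp_initial U _ G set_val) => -[x y].
apply: (@continuous2_cvg _ G G G (nbhs (x, y)) _ (val \o fst) (val \o snd)
  (fun a b => a * b)); first exact: (mulg_continuous (val x, val y)).
  by apply: cvg_comp; [exact: cvg_fst|exact: subg_val_continuous].
by apply: cvg_comp; [exact: cvg_snd|exact: subg_val_continuous].
Qed.

Fact subg_inv_continuous : continuous (fun x : U => x^-1).
Proof.
apply: (@continuous_comp_initial U _ G set_val) => x.
apply: (@continuous_comp _ _ _ (val : U -> G) (fun a : G => a^-1)).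
  exact: subg_val_continuous.
exact: invg_continuous.
Qed.

HB.instance Definition _ := PreTopologicalGroup_isTopologicalGroup.Build
  (set_type U) subg_mul_continuous subg_inv_continuous.

End OpenSubgroupType.

Program Definition subgI (G : topGroupType) (U V : openSubgroup G) :=
  @OpenSubgroup G (U `&` V) _ _ _ _.
Next Obligation. by move=> G U V; apply: openI; apply: subg_open. Qed.
Next Obligation. by move=> G U V; split; apply: subg1. Qed.
Next Obligation.
by move=> G U V x y [Ux Vx] [Uy Vy]; split; apply: subgM.
Qed.
Next Obligation. by move=> G U V x [Ux Vx]; split; apply: subgV. Qed.

Program Definition subgT (G : topGroupType) :=
  @OpenSubgroup G setT openT _ _ _.
Next Obligation. by []. Qed.
Next Obligation. by []. Qed.
Next Obligation. by []. Qed.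

Record topIso (G H : topGroupType) := TopIso {
  iso_fun :> G -> H;
  iso_inv : H -> G;
  isoM : {morph iso_fun : x y / x * y};
  isoK : cancel iso_fun iso_inv;
  isoKV : cancel iso_inv iso_fun;
  iso_continuous : continuous iso_fun;
  iso_inv_continuous : continuous iso_inv
}.

Lemma topIsoP (G H : topGroupType) (a b : topIso G H) :
  (forall x, a x = b x) -> a = b.
Proof.
move=> ab; have fE : iso_fun a = iso_fun b by apply: funext.
have gE : iso_inv a = iso_inv b.
  by apply: funext => y; rewrite -{1}(isoKV b y) -ab isoK.
case: a b fE gE {ab} => [f g ? ? ? ? ?] [f' g' ? ? ? ? ?] /= fE gE.
by subst f' g'; congr TopIso; apply: Prop_irrelevance.
Qed.

Section Aut.
Context (G : topGroupType).

Definition Aut := topIso G G.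

HB.instance Definition _ := gen_eqMixin Aut.
HB.instance Definition _ := gen_choiceMixin Aut.

Program Definition aut_one : Aut := @TopIso G G id id _ _ _ _ _.
Next Obligation. by []. Qed.
Next Obligation. by []. Qed.
Next Obligation. by []. Qed.
Next Obligation. by move=> x; apply: cvg_id. Qed.
Next Obligation. by move=> x; apply: cvg_id. Qed.

Program Definition aut_inv (a : Aut) : Aut :=
  @TopIso G G (iso_inv a) a _ _ _ _ _.
Next Obligation.
by move=> a x y; rewrite -{1}(isoKV a x) -{1}(isoKV a y) -isoM isoK.
Qed.
Next Obligation. exact: isoKV. Qed.
Next Obligation. exact: isoK. Qed.
Next Obligation. exact: iso_inv_continuous. Qed.
Next Obligation. exact: iso_continuous. Qed.

Program Definition aut_mul (a b : Aut) : Aut :=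
  @TopIso G G (a \o b) (iso_inv b \o iso_inv a) _ _ _ _ _.
Next Obligation. by move=> a b x y; rewrite /= !isoM. Qed.
Next Obligation. by move=> a b x; rewrite /= !isoK. Qed.
Next Obligation. by move=> a b x; rewrite /= !isoKV. Qed.
Next Obligation.
by move=> a b x; apply: continuous_comp; apply: iso_continuous.
Qed.
Next Obligation.
by move=> a b x; apply: continuous_comp; apply: iso_inv_continuous.
Qed.

Fact aut_mulA : associative aut_mul.
Proof. by move=> a b c; apply: topIsoP. Qed.
Fact aut_mul1 : left_id aut_one aut_mul.
Proof. by move=> a; apply: topIsoP. Qed.
Fact aut_mulr1 : right_id aut_one aut_mul.
Proof. by move=> a; apply: topIsoP. Qed.
Fact aut_mulV : left_inverse aut_one aut_inv aut_mul.
Proof. by move=> a; apply: topIsoP => x; apply: isoK. Qed.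
Fact aut_mulrV : right_inverse aut_one aut_inv aut_mul.
Proof. by move=> a; apply: topIsoP => x; apply: isoKV. Qed.

HB.instance Definition _ :=
  isGroup.Build Aut aut_mulA aut_mul1 aut_mulr1 aut_mulV aut_mulrV.

Definition autA (O : openSubgroup G) : set Aut :=
  [set c : Aut | forall g, subg_set O (g^-1 * c g)].

(* A set is a neighborhood of [c] when it contains a coset [c * autA O]. *)
Definition aut_open : set_system Aut :=
  [set W | forall c, W c ->
    exists O : openSubgroup G, [set c * d | d in autA O] `<=` W].

Fact aut_openT : aut_open setT.
Proof. by move=> c _; exists (subgT G). Qed.

Fact aut_openI : setI_closed aut_open.
Proof.
move=> W1 W2 o1 o2 c [/o1[O1 h1] /o2[O2 h2]]; exists (subgI O1 O2).
by move=> _ [d Ad <-]; split; [apply: h1|apply: h2]; exists d => // g;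
  have [] := Ad g.
Qed.

Fact aut_open_bigcup (I : Type) (f : I -> set Aut) :
  (forall i, aut_open (f i)) -> aut_open (\bigcup_i f i).
Proof.
move=> fo c [i _ /fo[O hO]]; exists O; apply: subset_trans hO _.
exact: bigcup_sup.
Qed.

HB.instance Definition _ :=
  isOpenTopological.Build Aut aut_openT aut_openI aut_open_bigcup.

Lemma nbhs_autE (c : Aut) (W : set Aut) :
  nbhs c W <-> exists O : openSubgroup G, [set c * d | d in autA O] `<=` W.
Proof.
rewrite nbhsE; split=> [[B [oB Bc] BW]|[O OW]].
  by have [O OB] := oB c Bc; exists O; apply: subset_trans BW.
exists [set c * d | d in autA O] => //; split; last first.
  by exists 1; rewrite ?mulg1// => g /=; rewrite mulVg; apply: subg1.
move=> _ [d Ad <-]; exists O => _ [e Ae <-].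
exists (d * e); last by rewrite mulgA.
move=> g; rewrite -(mulVKg (e g) ((d * e) g)) mulgA.
by apply: subgM; [exact: Ae|exact: Ad].
Qed.

Definition TAut : set Aut :=
  [set a : Aut | exists W : openSubgroup G, forall x, subg_set W x -> a x = x].

End Aut.

Arguments TAut G : clear implicits.

Section Commensurator.
Context (G : topGroupType).

Record vAut := VAut {
  va_dom : openSubgroup G;
  va_cod : openSubgroup G;
  va_iso :> topIso va_dom va_cod
}.

HB.instance Definition _ := gen_eqMixin vAut.
HB.instance Definition _ := gen_choiceMixin vAut.

Definition vAut_equiv (a b : vAut) : Prop :=
  exists W : openSubgroup G,
    [/\ W `<=` va_dom a, W `<=` va_dom b &
      forall (x : va_dom a) (y : va_dom b),
        val x = val y -> subg_set W (val x) -> val (a x) = val (b y)].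

Fact vAut_equiv_refl : reflexive (fun a b => `[< vAut_equiv a b >]).
Proof.
by move=> a; apply/asboolP; exists (va_dom a); split=> // x y /val_inj ->.
Qed.

Fact vAut_equiv_sym : symmetric (fun a b => `[< vAut_equiv a b >]).
Proof.
suff H a b : vAut_equiv a b -> vAut_equiv b a.
  by move=> a b; apply/asboolP/asboolP; apply: H.
move=> [W [Wa Wb ab]]; exists W; split=> // x y xy Wx.
by rewrite (ab y x) // -xy.
Qed.

Fact vAut_equiv_trans : transitive (fun a b => `[< vAut_equiv a b >]).
Proof.
move=> b a c /asboolP[W [Wa Wb ab]] /asboolP[W' [W'b W'c bc]].
apply/asboolP; exists (subgI W W'); split=> [x [/Wa]|x [_ /W'c]|x y xy []] //.
move=> Wx W'x; pose z : va_dom b := exist _ (val x) (mem_set (Wb _ Wx)).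
by rewrite (ab x z) // (bc z y).
Qed.

Canonical vAut_equiv_rel := EquivRel (fun a b : vAut => `[< vAut_equiv a b >])
  vAut_equiv_refl vAut_equiv_sym vAut_equiv_trans.

(* The underlying set of the commensurator. *)
Definition Comm := {eq_quot vAut_equiv_rel}.

Definition rho (U : openSubgroup G) (a : Aut U) : Comm := \pi_Comm (VAut a).
Arguments rho U a : clear implicits.

Definition uAut (U : openSubgroup G) : set Comm := range (rho U).

(* [uAut U] is identified with the quotient of [Aut U] by the fibres of [rho U],
   i.e. by [TAut U]; its open sets are those of the quotient topology. *)
Definition uAut_open (U : openSubgroup G) (W : set Comm) : Prop :=
  W `<=` uAut U /\ open (rho U @^-1` W).

Definition Aut_stab (U V : openSubgroup G) : set (Aut U) :=
  let VU := [set x : U | subg_set V (val x)] in [set a : Aut U | a @` VU = VU].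
Arguments Aut_stab U V : clear implicits.

Definition uAut_stab (U V : openSubgroup G) : set Comm :=
  rho U @` Aut_stab U V.

(* The inclusion required in [uAut_open V (uAut_stab U V)] always holds. *)
Section Restriction.
Context (U V : openSubgroup G) (VU : V `<=` U).

Definition subg_incl (x : V) : U :=
  exist _ (val x) (mem_set (VU (set_mem (valP x)))).

Definition subg_res (f : U -> U)
    (fV : forall x : U, subg_set V (val x) -> subg_set V (val (f x))) (x : V) : V :=
  exist _ (val (f (subg_incl x)))
    (mem_set (fV (subg_incl x) (set_mem (valP x)))).

Fact subg_incl_continuous : continuous subg_incl.
Proof.
apply: (@continuous_comp_initial U _ G set_val) => x.
exact: subg_val_continuous.
Qed.

Fact subg_res_continuous f fV : continuous f -> continuous (@subg_res f fV).
Proof.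
move=> fc; apply: (@continuous_comp_initial V _ G set_val) => x.
apply: (@continuous_comp _ _ _ (f \o subg_incl) (val : U -> G)).
  apply: continuous_comp; first exact: subg_incl_continuous.
  exact: fc.
exact: subg_val_continuous.
Qed.

Lemma uAut_stab_sub : uAut_stab U V `<=` uAut V.
Proof.
move=> _ [a aV <-].
have fV (x : U) : subg_set V (val x) -> subg_set V (val (a x)).
  move=> Vx; suff: (a @` [set x : U | subg_set V (val x)]) (a x) by rewrite aV.
  by exists x.
have gV (y : U) : subg_set V (val y) -> subg_set V (val (iso_inv a y)).
  move=> Vy; have : (a @` [set x : U | subg_set V (val x)]) y by rewrite aV.
  by move=> [x Vx <-]; rewrite isoK.
have fM : {morph subg_res fV : x y / x * y}.
  move=> x y; apply: val_inj; rewrite [LHS]/(val (a (subg_incl (x * y)))).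
  have -> : subg_incl (x * y) = subg_incl x * subg_incl y by apply: val_inj.
  by rewrite isoM.
have fK : cancel (subg_res fV) (subg_res gV).
  move=> x; apply: val_inj; transitivity (val (iso_inv a (a (subg_incl x)))).
    by congr (val (iso_inv a _)); apply: val_inj.
  by rewrite isoK.
have gK : cancel (subg_res gV) (subg_res fV).
  move=> x; apply: val_inj; transitivity (val (a (iso_inv a (subg_incl x)))).
    by congr (val (a _)); apply: val_inj.
  by rewrite isoKV.
exists (TopIso fM fK gK (subg_res_continuous (@iso_continuous _ _ a))
  (subg_res_continuous (@iso_inv_continuous _ _ a))) => //.
apply/eqmodP/asboolP; exists V; split=> // x y xy _.
by congr (val (a _)); apply: val_inj.
Qed.

End Restriction.

Definition Aut_stable (U : openSubgroup G) : Prop :=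
  forall V : openSubgroup G, V `<=` U -> uAut_open V (uAut_stab U V).

Definition Aut1 : Prop := forall U : openSubgroup G, closed (TAut U).

Definition Aut2 : Prop := Aut1 /\ exists U : openSubgroup G, Aut_stable U.

End Commensurator.

Definition profinite (G : topGroupType) : Prop :=
  [/\ compact [set: G], hausdorff_space G & totally_disconnected [set: G]].

Definition subg_normal (G : topGroupType) (N : openSubgroup G) : Prop :=
  forall x g : G, subg_set N x -> subg_set N (x ^ g).

Definition lcosets (G : topGroupType) (N : openSubgroup G) : set (set G) :=
  [set [set g * n | n in N] | g in [set: G]].

Definition pro_p (p : nat) (G : topGroupType) : Prop :=
  profinite G /\ forall N : openSubgroup G, subg_normal N ->
    exists k, (lcosets N #= `I_(p ^ k)%N)%card.

Definition free_pro_p_basis (p r : nat) (G : topGroupType) (x : 'I_r -> G) :=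
  forall (H : topGroupType) (y : 'I_r -> H), pro_p p H ->
    exists! f : G -> H,
      [/\ continuous f, {morph f : a b / a * b} & forall i, f (x i) = y i].

Definition free_pro_p (p r : nat) (G : topGroupType) : Prop :=
  pro_p p G /\ exists x : 'I_r -> G, free_pro_p_basis p x.

(* Main.v *)
From HB Require Import structures.
From mathcomp Require Import all_boot all_fingroup all_solvable.
From mathcomp Require Import zmodp finmap all_classical topology.
Require Import Defs.

(** Let [phi] be a continuous surjection of [G] onto a finite [p]-group [Q].  By
    the universal property of [G] applied to wreath products [K wr Q], every
    labelling of the edges [q -> q * phi x_i] of the Cayley graph of [Q] by
    elements of a pro-[p] group [K] extends uniquely to a continuous labelling
    [F : G -> Q -> K] of the paths [q -> q * phi g]; this makes Schreier bases of
    open subgroups unnecessary.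

    Labelling one edge by a generator of a large cyclic group and all others by
    1, one sees that an element commuting with [x_i ^ k] lies in the closed
    subgroup generated by [x_i].  Two such subgroups meet trivially, so open
    subgroups have trivial centralizers, which forces [TAut U = 1].

    Let [U] be open, [a = x_0], [b = x_1], [u = a ^ s0] in [U], and let [N <= U]
    be the kernel of a [phi] with [phi u] outside [<phi b>].  Label the edge
    [1 -> phi b] by [z * b] and every other edge [x_i] by [x_i], where [z] is a
    power of [a] close to 1.  Then [n |-> F n 1] is an automorphism of [N] close
    to 1 (its inverse comes from [z^-1]).  It sends [u^-1 b^k u] to a conjugate of
    [b^k], but [b^k] to an element with non-trivial image in the abelianization
    modulo [b]; for an automorphism of [U] agreeing with it on an open subgroup,
    these two images would be conjugate. *)

Set Implicit Arguments.
Unset Strict Implicit.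
Unset Printing Implicit Defensive.

Local Open Scope classical_set_scope.
Local Open Scope group_scope.

(** * Open subgroups of profinite groups *)

(** If no such [C] fits into [U], the closed differences of [C] and [U] form a filter base. A
    cluster point lies in every [C], hence in [U] by hypothesis, and yet outside [U]. *)
Lemma compact_quasi_component (T : topologicalType) (x : T) (U : set T) :
  compact [set: T] -> open U ->
  (forall y, (forall C, clopen C -> C x -> C y) -> U y) ->
  exists C, [/\ clopen C, C x & C `<=` U].
Proof.
move=> cT oU QU; apply: contrapT => nC.
pose F := filter_from [set C : set T | clopen C /\ C x] (fun C => C `\` U).
have FF : ProperFilter F.
  apply: filter_from_proper; last first.
    move=> C [cC Cx]; apply/set0P/eqP => CU; apply: nC; exists C.
    by split=> // z Cz; apply: contrapT => nUz; have : set0 z by rewrite -CU.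
  apply: filter_from_filter; first by exists setT; split=> //; exact: clopenT.
  move=> A B [cA Ax] [cB Bx]; exists (A `&` B).
    by split=> //; exact: clopenI.
  by move=> z [[Az Bz] nUz].
have [|y [_ Fy]] := cT F FF.
  by exists setT => //; split=> //; exact: clopenT.
have FC C : clopen C -> C x -> closure (C `\` U) y.
  by move=> cC Cx B By; apply: Fy By; exists C.
have : closure (~` U) y.
  have := FC setT clopenT I; apply: closureS => z [].
  by [].
rewrite -(iffLR (closure_id _)); last exact: open_closedC.
apply; apply: QU => C cC Cx; have : closure C y.
  by apply: closureS (FC C cC Cx) => z [].
by rewrite -(iffLR (closure_id _))//; case: cC.
Qed.

(** The quasi-component [Q] of [x] is connected: normality separates two closed pieces of [Q] by
    open sets, a clopen neighborhood of [Q] in their union splits into two clopen halves, and the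
    half containing [x] must contain all of [Q]. *)
Lemma compact_totally_disconnected_zero_dimensional (T : topologicalType) :
  compact [set: T] -> hausdorff_space T -> totally_disconnected [set: T] ->
  zero_dimensional T.
Proof.
move=> cT hT tdT x y /eqP xy; apply: contrapT => nU; apply: xy.
pose Q := [set z | forall C, clopen C -> C x -> C z].
have Qx : Q x by [].
have Qy : Q y.
  by move=> C cC Cx; apply: contrapT => nCy; apply: nU; exists C.
have clQ : closed Q.
  rewrite (_ : Q = \bigcap_(C in [set C | clopen C /\ C x]) C).
    by apply: closed_bigI => C [[]].
  by apply/seteqP; split=> z /= Qz C => [[cC Cx]|cC Cx]; apply: Qz.
suff conQ : connected Q.
  have : connected_component setT x y by exists Q => //; split.
  by rewrite tdT//= => ->.
move=> B [b Bb] [C1 oC1 BC1] [C2 cC2 BC2].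
have clB : closed B by rewrite BC2; apply: closedI.
have clD : closed (Q `\` B).
  rewrite (_ : Q `\` B = Q `&` ~` C1); last first.
    apply/seteqP; split=> z [Qz nz]; split=> // Hz; apply: nz.
      by rewrite BC1.
    by move: Hz; rewrite BC1 => -[].
  by apply: closedI => //; apply: open_closedC.
have nDB : set_nbhs B (~` (Q `\` B)).
  by apply/set_nbhsP; exists (~` (Q `\` B)); split=> //; [exact: closed_openC|
    move=> z Bz []].
have [V nV sV] := compact_normal hT cT clB nDB.
have /set_nbhsP[O1 [oO1 BO1 O1V]] := nV.
have oO2 : open (~` closure V) by apply: closed_openC; exact: closed_closure.
have DO2 : Q `\` B `<=` ~` closure V by move=> z Dz /sV; apply.
have [||C [[oC cC] Cx CO]] :=
  @compact_quasi_component T x (O1 `|` ~` closure V) cT.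
- exact: openU.
- move=> z Qz; have [Bz|nBz] := pselect (B z); first by left; apply: BO1.
  by right; apply: DO2.
(* Inside [C], the open set [O1] and the closed set [closure V] coincide. *)
have clO1 : clopen (C `&` O1).
  split; first exact: openI.
  rewrite (_ : C `&` O1 = C `&` closure V).
    by apply: closedI => //; exact: closed_closure.
  apply/seteqP; split=> z [Cz Hz]; split=> //; first exact/subset_closure/O1V.
  by have [] := CO _ Cz.
have clO2 : clopen (C `&` ~` closure V).
  split; first exact: openI.
  rewrite (_ : C `&` ~` closure V = C `&` ~` O1).
    by apply: closedI => //; exact: open_closedC.
  apply/seteqP; split=> z [Cz Hz]; split=> //; last by have [] := CO _ Cz.
  by move=> /O1V /subset_closure.
have Qb : Q b by move: Bb; rewrite BC1 => -[].
have [Bx|nBx] := pselect (B x).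
  apply/seteqP; split=> [z|z Qz]; first by rewrite BC1 => -[].
  apply: contrapT => nBz.
  have [_ O1z] := Qz _ clO1 (conj Cx (BO1 _ Bx)).
  exact: (DO2 z (conj Qz nBz)) (subset_closure (O1V _ O1z)).
have [_] := Qb _ clO2 (conj Cx (DO2 _ (conj Qx nBx))).
by case; apply: subset_closure; apply: O1V; apply: BO1.
Qed.

Lemma mulgl_continuous (G : topGroupType) (x : G) : continuous (fun y => x * y).
Proof.
move=> y U /(@mulg_continuous G (x, y))[[A B] /= [Ax By] AB].
apply: filterS By => z Bz; apply: (AB (x, z)); split=> //=.
exact: nbhs_singleton.
Qed.

Lemma subgroup_nbhs1_open (G : topGroupType) (S : set G) :
  (forall x y, S x -> S y -> S (x * y)) -> nbhs 1 S -> open S.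
Proof.
move=> SM S1; rewrite openE => x Sx.
have := @mulgl_continuous G x^-1 x S; rewrite /= mulVg => /(_ S1) nx.
apply: filterS (nx : nbhs x _) => y /= Sy.
by rewrite -(mulVKg x y); exact: SM.
Qed.

Lemma profinite_separation (G : topGroupType) (g : G) :
  profinite G -> g <> 1 -> exists W : openSubgroup G, ~ subg_set W g.
Proof.
move=> [cG hG tG] /eqP g1.
have zdG := compact_totally_disconnected_zero_dimensional cG hG tG.
rewrite eq_sym in g1; have [C [[oC cC] C1 nCg]] := zdG _ _ g1.
(* The stabilizer of a clopen set under left translation is an open subgroup. *)
pose S := [set h | forall c, C c <-> C (h * c)].
have S1 : S 1 by move=> c; rewrite mul1g.
have SM x y : S x -> S y -> S (x * y).
  by move=> Sx Sy c; rewrite -mulgA; apply: (iff_trans (Sy c)).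
have SV x : S x -> S x^-1.
  by move=> Sx c; have := Sx (x^-1 * c); rewrite mulVKg => H; split=> /H.
(* Products stay in [C] near each pair of 1 and a point of [C]; compactness of [C] and of its
   complement gives one neighborhood of 1 that serves for all points. *)
have nS : nbhs 1 S.
  have cC' : compact C by apply: subclosed_compact cC cG _.
  have cN : compact (~` C).
    by apply: subclosed_compact (open_closedC oC) cG _.
  have contM (c : G) (D : set G) : open D -> D c ->
      \forall c' \near c & h \near nbhs (1 : G), D (h * c').
    move=> oD Dc; have := @mulg_continuous G (1, c) D.
    rewrite /= mul1g => /(_ (open_nbhs_nbhs (conj oD Dc))) [[A B] /= [A1 Bc] AB].
    by exists (B, A) => // -[c' h] /= [Bc' Ah]; apply: (AB (h, c')).
  have H1 := (iffLR (compact_near_coveringP _) cC') G (nbhs 1)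
    (fun h c => C (h * c)) (nbhs_filter 1) (fun c => contM c C oC).
  have H2 := (iffLR (compact_near_coveringP _) cN) G (nbhs 1)
    (fun h c => ~ C (h * c)) (nbhs_filter 1)
    (fun c => contM c (~` C) (closed_openC cC)).
  near=> h => c; split=> Cc.
    exact: (near H1 h _ c Cc).
  by apply: contrapT => nCc; exact: (near H2 h _ c nCc Cc).
have oS := subgroup_nbhs1_open SM nS.
exists (@OpenSubgroup G S oS S1 SM SV) => Sg.
by apply: nCg; rewrite -(mulg1 g) -Sg.
Unshelve. all: by end_near.
Qed.

(** * Finite quotients *)

Lemma mulgr_continuous (G : topGroupType) (x : G) : continuous (fun y => y * x).
Proof.
move=> y U /(@mulg_continuous G (y, x))[[A B] /= [Ay Bx] AB].
apply: filterS Ay => z Az; apply: (AB (z, x)); split=> //=.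
exact: nbhs_singleton.
Qed.

(** [T] stands for the set of cosets [U g], [rep] for the projection and [s] for a section. *)
Lemma finite_cosets (G : topGroupType) (U : openSubgroup G) :
  compact [set: G] -> exists (T : finType) (rep : G -> T) (s : T -> G),
    (forall g h, rep g = rep h <-> subg_set U (g * h^-1)) /\ cancel s rep.
Proof.
move=> cG; pose pG : ptopologicalType :=
  HB.pack (G : Type) (Topological.on G) (isPointed.Build G 1).
have {}cG : @cover_compact pG setT by rewrite -compact_cover.
have [||D _ GD] := cG G setT (fun c => [set g | subg_set U (g * c^-1)]).
- move=> c _; apply: (open_comp (in1W (@mulgr_continuous G c^-1))).
  exact: subg_open.
- by move=> g _; exists g => //=; rewrite mulgV; exact: subg1.
pose l : seq G := enum_fset D.
(* Position of the first entry of [l] in the coset [U g], which depends on the coset only. *)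
pose idx g := find (fun c => `[< subg_set U (g * c^-1) >]) l.
have hasl g : has (fun c => `[< subg_set U (g * c^-1) >]) l.
  by have [c Dc Uc] := GD g I; apply/hasP; exists c => //; exact/asboolP.
have idxlt g : idx g < size l by rewrite -has_find.
have idxU g : subg_set U (g * (nth 1 l (idx g))^-1).
  exact/asboolP/(nth_find 1 (hasl g)).
have idxP g h : idx g = idx h <-> subg_set U (g * h^-1).
  split=> [E|Ugh].
    rewrite (_ : g * h^-1 = (g * (nth 1 l (idx g))^-1) *
        (h * (nth 1 l (idx h))^-1)^-1).
      by apply: subgM => //; apply: subgV.
    by rewrite E invgM invgK !mulgA mulgKV.
  apply: eq_find => c; apply/asboolP/asboolP => Uc.
    rewrite (_ : h * c^-1 = (g * h^-1)^-1 * (g * c^-1)).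
      by apply: subgM => //; apply: subgV.
    by rewrite invgM invgK !mulgA mulgKV.
  rewrite (_ : g * c^-1 = (g * h^-1) * (h * c^-1)); first exact: subgM.
  by rewrite !mulgA mulgKV.
have idxK g : idx (nth 1 l (idx g)) == idx g.
  by apply/eqP/esym/idxP.
(* Keeping only the positions that index their own entry makes [nth] a section. *)
pose T : finType := {i : 'I_(size l) | idx (nth 1 l i) == i}.
exists T, (fun g => exist _ (Ordinal (idxlt g)) (idxK g)),
  (fun t : T => nth 1 l (val (val t))).
split=> [g h|[i iP]]; last exact/val_inj/val_inj/eqP.
by rewrite -idxP; split=> [[]//|E]; apply/val_inj/val_inj.
Qed.

(** Continuity into the finite discrete group is expressed by the kernel being a neighborhood of
    1. *)
Definition quotient_map (G : topGroupType) (Q : finGroupType) (phi : G -> Q) :=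
  [/\ {morph phi : a b / a * b}, forall q, exists g, phi g = q &
      nbhs 1 [set g | phi g = 1]].

Lemma morph_one (G H : groupType) (f : G -> H) :
  {morph f : a b / a * b} -> f 1 = 1.
Proof. by move=> fM; apply: (mulgI (f 1)); rewrite -fM !mulg1. Qed.

Lemma morph_inv (G H : groupType) (f : G -> H) :
  {morph f : a b / a * b} -> {morph f : a / a^-1}.
Proof.
by move=> fM a; apply: (mulgI (f a)); rewrite -fM !mulgV morph_one.
Qed.

Lemma morph_exp (G H : groupType) (f : G -> H) n :
  {morph f : a b / a * b} -> {morph f : a / a ^+ n}.
Proof.
move=> fM a; elim: n => [|n IH]; first by rewrite !expg0 morph_one.
by rewrite !expgS fM IH.
Qed.

(** [Q] is the image of the permutation action of [G] on the cosets [U g] by right translation; the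
    kernel of this action is the normal core of [U]. *)
Lemma exists_quotient_map (G : topGroupType) (U : openSubgroup G) :
  compact [set: G] -> exists (Q : finGroupType) (phi : G -> Q),
    quotient_map phi /\
    forall g, phi g = 1 <-> forall h, subg_set U (h * g * h^-1).
Proof.
move=> cG; have [T [rep [s [repP sK]]]] := finite_cosets U cG.
have reps g h : rep (s (rep g) * h) = rep (g * h).
  by apply/repP; rewrite invgM mulgA mulgK; apply/repP.
pose act g t := rep (s t * g).
have actM g h t : act (g * h) t = act h (act g t).
  by rewrite /act reps mulgA.
have act1 t : act 1 t = t by rewrite /act mulg1.
have act_inj g : injective (act g).
  by apply: (can_inj (g := act g^-1)) => t; rewrite -actM mulgV.
pose f g := perm (@act_inj g).
have fM : {morph f : a b / a * b}.
  by move=> a b; apply/permP => t; rewrite permM !permE.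
pose P := [set q | `[< exists g, f g = q >]]%SET.
have gP : group_set P.
  apply/group_setP; split=> [|x y]; rewrite !inE.
    by exists 1; exact: morph_one.
  move=> [g <-] [h <-]; exists (g * h).
  exact: fM.
have Pf g : f g \in Group gP by rewrite !inE; exists g.
exists (subg_of (Group gP) : finGroupType), (fun g => subg (Group gP) (f g)).
have E g : subg (Group gP) (f g) = 1 -> f g = 1.
  by move=> /(congr1 sgval); rewrite subgK.
have phi1 g : (forall h, subg_set U (h * g * h^-1)) ->
    subg (Group gP) (f g) = 1.
  move=> Ug; apply: val_inj; rewrite /= subgK//.
  by apply/permP => t; rewrite permE perm1 -[RHS]sK; apply/repP.
split; last first.
  move=> g; split=> [/E/permP fg h|]; last exact: phi1.
  have := fg (rep h); rewrite permE perm1 /act reps.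
  by move=> /repP.
split=> [a b|q|].
- by rewrite fM; apply: val_inj; rewrite /= !subgK// groupM.
- have := subgP q; rewrite !inE => -[g fg]; exists g.
  by rewrite fg; exact: sgvalK.
(* Conjugating by the finitely many [s t] is enough, since every [h] is an element of [U] times some
   [s t]. *)
have : \forall g \near nbhs (1 : G), forall t, subg_set U (s t * g * (s t)^-1).
  apply: filter_forall => t.
  have := continuous_comp (@mulgl_continuous G (s t) 1)
    (@mulgr_continuous G (s t)^-1 _); apply.
  rewrite /= mulg1 mulgV; apply: open_nbhs_nbhs.
  by split; [exact: subg_open|exact: subg1].
apply: filterS => g /= Ug; apply: phi1 => h.
rewrite (_ : h * g * h^-1 = (h * (s (rep h))^-1) *
  (s (rep h) * g * (s (rep h))^-1) * (h * (s (rep h))^-1)^-1); last by rewrite invgM invgK !mulgA !mulgKV.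
have Uh : subg_set U (h * (s (rep h))^-1) by apply/repP; rewrite sK.
by apply: subgM; [apply: subgM|apply: subgV].
Qed.

Lemma kernel_openSubgroup (G : topGroupType) (Q : groupType) (phi : G -> Q) :
  {morph phi : a b / a * b} -> nbhs 1 [set g | phi g = 1] ->
  exists2 N : openSubgroup G, subg_normal N &
    forall g, subg_set N g <-> phi g = 1.
Proof.
move=> phiM phi1.
have SM x y : phi x = 1 -> phi y = 1 -> phi (x * y) = 1.
  by move=> x1 y1; rewrite phiM x1 y1 mulg1.
have SV x : phi x = 1 -> phi x^-1 = 1.
  by move=> x1; rewrite morph_inv// x1 invg1.
exists (OpenSubgroup (subgroup_nbhs1_open SM phi1) (morph_one phiM) SM SV) => //.
move=> x g /= x1; rewrite /conjg !phiM x1 mul1g -phiM mulVg.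
exact: morph_one.
Qed.

Lemma card_quotient (G : topGroupType) (Q : finGroupType) (phi : G -> Q)
    (N : openSubgroup G) : quotient_map phi ->
  (forall g, subg_set N g <-> phi g = 1) -> (lcosets N #= `I_#|Q|)%card.
Proof.
move=> [phiM phiS _] NP.
have phiV := morph_inv phiM.
have -> : lcosets N = (fun q => [set g | phi g = q]) @` [set: Q].
  have cosetE g : [set g * n | n in subg_set N] = [set h | phi h = phi g].
    apply/seteqP; split=> [_ [n /NP n1 <-]|h /= hg].
      by rewrite /= phiM n1 mulg1.
    exists (g^-1 * h); last by rewrite mulVKg.
    by apply/NP; rewrite phiM hg phiV mulVg.
  apply/seteqP; split=> [_ [g _ <-]|_ [q _ <-]].
    by exists (phi g) => //; rewrite cosetE.
  by have [g <-] := phiS q; exists g => //; rewrite cosetE.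
apply: (card_eq_trans (inj_card_eq _)).
  move=> q q' _ _ qq'; have [g gq] := phiS q.
  have : [set g | phi g = q] g by [].
  by rewrite qq' /= gq.
apply/pcard_eqP/bijPex; exists (fun q => nat_of_ord (enum_rank q)); split.
- by move=> q _ /=.
- by move=> q q' _ _ /ord_inj/enum_rank_inj.
- by move=> i /= iQ; exists (enum_val (Ordinal iQ)) => //; rewrite enum_valK.
Qed.

Lemma pro_p_quotient (p : nat) (G : topGroupType) (Q : finGroupType)
    (phi : G -> Q) : pro_p p G -> quotient_map phi ->
  prime p -> p.-group [set: Q]%SET.
Proof.
move=> [_ pG] qphi; have [phiM _ phi1] := qphi.
move=> p_pr; have [N nN NP] := kernel_openSubgroup phiM phi1.
have [k Nk] := pG N nN.
have := card_eq_trans (card_esym (card_quotient qphi NP)) Nk.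
by move=> /card_eq_II E; rewrite /pgroup cardsT E pnatX pnat_id.
Qed.

Lemma pgroup_of_exponent (p : nat) (Q : finGroupType) :
  (forall q : Q, exists k, q ^+ (p ^ k)%N = 1) -> prime p ->
  p.-group [set: Q]%SET.
Proof.
move=> H p_pr; apply/pgroupP => l l_pr lQ.
have [q _ ql] := Cauchy l_pr lQ.
have [k qk] := H q; have : l %| (p ^ k)%N by rewrite -ql order_dvdn qk.
by rewrite Euclid_dvdX// dvdn_prime2// => /andP[/eqP -> _]; rewrite inE.
Qed.

(** By Cauchy's theorem, [p]-power exponents in the finite quotients already make them [p]-groups,
    so no cosets have to be counted. *)
Lemma pro_p_exponent (p : nat) (G : topGroupType) : prime p -> profinite G ->
  (forall (N : openSubgroup G) (g : G), subg_normal N ->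
    exists k, subg_set N (g ^+ (p ^ k)%N)) ->
  pro_p p G.
Proof.
move=> p_pr pfG H; split=> // N nN; have [cG _ _] := pfG.
have [Q [phi [qphi phiN]]] := exists_quotient_map N cG.
have {}phiN g : subg_set N g <-> phi g = 1.
  rewrite phiN; split=> [Ng h|/(_ 1)]; last by rewrite mul1g invg1 mulg1.
  by have := nN _ h^-1 Ng; rewrite /conjg invgK mulgA.
have := card_quotient qphi phiN.
have /card_pgroup : p.-group [set: Q]%SET.
  apply: pgroup_of_exponent => // q; have [phiM /(_ q)[g <-] _] := qphi.
  by have [k /phiN gk] := H N g nN; exists k; rewrite -morph_exp.
by rewrite cardsT => ->; exists (logn p #|Q|).
Qed.

Lemma pro_p_power_mem (p : nat) (G : topGroupType) (U : openSubgroup G) :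
  prime p -> pro_p p G -> exists e, forall g, subg_set U (g ^+ (p ^ e)%N).
Proof.
move=> p_pr pG; have [cG _ _] := pG.1.
have [Q [phi [qphi phiU]]] := exists_quotient_map U cG.
exists (logn p #|Q|) => g.
have /phiU/(_ 1) : phi (g ^+ (p ^ logn p #|Q|)%N) = 1.
  have [phiM _ _] := qphi; rewrite morph_exp//.
  by rewrite -cardsT -(card_pgroup (pro_p_quotient pG qphi p_pr)) expg_cardG ?inE.
by rewrite mul1g invg1 mulg1.
Qed.

Lemma preimage_openSubgroup (G H : topGroupType) (f : G -> H) (U : openSubgroup H) :
  {morph f : a b / a * b} -> continuous f ->
  exists V : openSubgroup G, forall g, subg_set V g <-> subg_set U (f g).
Proof.
move=> fM fc.
have SM x y : subg_set U (f x) -> subg_set U (f y) -> subg_set U (f (x * y)).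
  by rewrite fM; exact: subgM.
have SV x : subg_set U (f x) -> subg_set U (f x^-1).
  by rewrite morph_inv//; exact: subgV.
have S1 : subg_set U (f 1) by rewrite morph_one//; exact: subg1.
have oS : open (f @^-1` U) by apply: open_comp => //; exact: subg_open.
by exists (@OpenSubgroup G _ oS S1 SM SV).
Qed.

(** * Wreath products *)

(** An alias, so that the discrete topology is attached to a name of its own and not to [Q]. *)
Definition disc (Q : finGroupType) : Type := Q.

Section DiscreteGroup.
Context (Q : finGroupType).

HB.instance Definition _ := FinGroup.copy (disc Q) Q.
HB.instance Definition _ := DiscreteTopology.copy (disc Q) (discrete_topology Q).

Fact disc_mul_continuous : continuous (fun x : disc Q * disc Q => x.1 * x.2).
Proof.
move=> [a b] U Uab; exists ([set a], [set b]).
  by split; exact: discrete_set1.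
by move=> [a' b'] /= [-> ->]; exact: nbhs_singleton.
Qed.

Fact disc_inv_continuous : continuous (fun x : disc Q => x^-1).
Proof.
move=> a U Ua; apply: (@filterS _ (nbhs a) _ _ _ _ (discrete_set1 a)) => _ /= ->.
exact: nbhs_singleton.
Qed.

HB.instance Definition _ := PreTopologicalGroup_isTopologicalGroup.Build
  (disc Q) disc_mul_continuous disc_inv_continuous.

Lemma disc_profinite : profinite (disc Q).
Proof.
split; first exact/finite_compact/finite_finset.
  exact: discrete_hausdorff.
apply: zero_dimension_totally_disconnected; exact: discrete_zero_dimension.
Qed.

Lemma disc_pro_p p : prime p -> p.-group [set: Q]%SET -> pro_p p (disc Q).
Proof.
move=> p_pr pQ; apply: pro_p_exponent => //; first exact: disc_profinite.
move=> N g nN; exists (logn p #|Q|).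
by rewrite -cardsT -card_pgroup// expg_cardG ?inE//; exact: subg1.
Qed.

End DiscreteGroup.

Definition wreath (K : topGroupType) (Q : finGroupType) : Type :=
  ({ptws Q -> K} * disc Q)%type.

Section Wreath.
Context (K : topGroupType) (Q : finGroupType).
Local Notation W := (wreath K Q).

HB.instance Definition _ := Topological.copy W ({ptws Q -> K} * disc Q)%type.

(** Read [x.1 q] as the label of a path from [q] to [q * x.2]; the product concatenates paths. *)
Definition wreath_mul (x y : W) : W :=
  (fun q => x.1 q * y.1 (q * x.2), x.2 * y.2).
Definition wreath_one : W := (fun=> 1, 1).
Definition wreath_inv (x : W) : W := (fun q => (x.1 (q * x.2^-1))^-1, x.2^-1).

Fact wreath_mulA : associative wreath_mul.
Proof.
move=> x y z; rewrite /wreath_mul /=; congr pair; last exact: mulgA.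
by apply: funext => q; rewrite !mulgA.
Qed.

Fact wreath_mul1 : left_id wreath_one wreath_mul.
Proof.
move=> [x a]; rewrite /wreath_mul /=; congr pair; last exact: mul1g.
by apply: funext => q; rewrite mul1g mulg1.
Qed.

Fact wreath_mulr1 : right_id wreath_one wreath_mul.
Proof.
move=> [x a]; rewrite /wreath_mul /=; congr pair; last exact: mulg1.
by apply: funext => q; rewrite mulg1.
Qed.

Fact wreath_mulV : left_inverse wreath_one wreath_inv wreath_mul.
Proof.
move=> [x a]; rewrite /wreath_mul /wreath_one /=; congr pair; last exact: mulVg.
by apply: funext => q; rewrite mulVg.
Qed.

Fact wreath_mulrV : right_inverse wreath_one wreath_inv wreath_mul.
Proof.
move=> [x a]; rewrite /wreath_mul /wreath_one /=; congr pair; last exact: mulgV.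
by apply: funext => q; rewrite mulgK mulgV.
Qed.

HB.instance Definition _ := isGroup.Build W
  wreath_mulA wreath_mul1 wreath_mulr1 wreath_mulV wreath_mulrV.

Lemma wreath_eqP (x y : W) : (forall q, x.1 q = y.1 q) -> x.2 = y.2 -> x = y.
Proof. by case: x y => [x a] [y b] /= /funext -> ->. Qed.

Lemma ptws_continuous (T : topologicalType) (f : T -> {ptws Q -> K}) :
  (forall q, continuous (fun t => f t q)) -> continuous f.
Proof.
move=> fc t; apply/cvg_sup => q U [V [[B oB <-] Bt] BU].
apply: (@filterS _ (nbhs t) _ _ _ (fun s => BU (f s))).
apply: fc; exact: open_nbhs_nbhs.
Qed.

Lemma wreath_continuous (T : topologicalType) (f : T -> W) :
  (forall q, continuous (fun t => (f t).1 q)) -> continuous (fun t => (f t).2) ->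
  continuous f.
Proof.
move=> fc1 fc2 t U [[A B] /= [fA fB] AB].
have cf1 : nbhs t [set s | A (f s).1].
  exact: (@ptws_continuous _ (fun t => (f t).1) fc1 t A fA).
have cf2 : nbhs t [set s | B (f s).2] by exact: fc2.
apply: filterS (filterI cf1 cf2) => s [As Bs].
exact: (AB (f s) (conj As Bs)).
Qed.

Lemma wreath_snd_continuous : continuous (fun x : W => x.2).
Proof. move=> x; exact: cvg_snd. Qed.

Lemma wreath_fst_continuous q : continuous (fun x : W => x.1 q).
Proof.
move=> x; apply: (@continuous_comp W {ptws Q -> K} K fst (fun f => f q)).
  exact: cvg_fst.
exact: (@proj_continuous Q (fun=> K) q).
Qed.

Fact wreath_mul_continuous : continuous (fun x : W * W => x.1 * x.2).
Proof.
have c1 : continuous (fun x : W * W => x.1) by move=> x; exact: cvg_fst.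
have c2 : continuous (fun x : W * W => x.2) by move=> x; exact: cvg_snd.
apply: wreath_continuous => [q|] x.
  apply: (@continuous2_cvg _ K K K (nbhs x) _
    (fun t => t.1.1 q) (fun t => t.2.1 (q * t.1.2)) (fun a b => a * b)).
  - exact: (mulg_continuous (x.1.1 q, x.2.1 (q * x.1.2))).
  - exact: (@continuous_comp (W * W)%type W K fst (fun w : W => w.1 q) x (c1 x)
      (@wreath_fst_continuous q x.1)).
  (* The component in [disc Q] is locally constant, so the coordinate being read can be frozen at
     its value for [x]. *)
  have nE : {near nbhs x, (fun t : W * W => t.2.1 (q * x.1.2)) =1
      (fun t : W * W => t.2.1 (q * t.1.2))}.
    have := @continuous_comp (W * W)%type W (disc Q) fst (fun w : W => w.2) x
      (c1 x) (@wreath_snd_continuous x.1).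
    move=> /(_ _ (discrete_set1 _)) nx; apply: filterS (nx : nbhs x _) => t /= E.
    by congr (_ (q * _)).
  apply: cvg_trans (near_eq_cvg nE) _.
  exact: (@continuous_comp (W * W)%type W K snd (fun w : W => w.1 (q * x.1.2)) x
    (c2 x) (@wreath_fst_continuous (q * x.1.2) x.2)).
apply: (@continuous2_cvg _ (disc Q) (disc Q) (disc Q) (nbhs x) _
    (fun t => t.1.2) (fun t => t.2.2) (fun a b => a * b)).
- exact: (mulg_continuous (x.1.2, x.2.2)).
- exact: (@continuous_comp (W * W)%type W (disc Q) fst (fun w : W => w.2) x
    (c1 x) (@wreath_snd_continuous x.1)).
- exact: (@continuous_comp (W * W)%type W (disc Q) snd (fun w : W => w.2) x
    (c2 x) (@wreath_snd_continuous x.2)).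
Qed.

Fact wreath_inv_continuous : continuous (fun x : W => x^-1).
Proof.
apply: wreath_continuous => [q x|x].
  apply: (@continuous_comp _ K K (fun t : W => t.1 (q * t.2^-1)) (fun a => a^-1)).
    have nE : {near nbhs x, (fun t : W => t.1 (q * x.2^-1)) =1
        (fun t : W => t.1 (q * t.2^-1))}.
      have := @wreath_snd_continuous x.
      move=> /(_ _ (discrete_set1 _)) nx; apply: filterS (nx : nbhs x _) => t /= E.
      by congr (_ (q * _^-1)).
    apply: cvg_trans (near_eq_cvg nE) _.
    exact: wreath_fst_continuous.
  exact: invg_continuous.
apply: (@continuous_comp _ (disc Q) (disc Q) (fun t : W => t.2) (fun a => a^-1)).
  exact: wreath_snd_continuous.
exact: invg_continuous.
Qed.

HB.instance Definition _ := PreTopologicalGroup_isTopologicalGroup.Build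
  W wreath_mul_continuous wreath_inv_continuous.

Lemma wreath_profinite : profinite K -> profinite W.
Proof.
move=> [cK hK tK]; have [cQ hQ tQ] := disc_profinite Q.
split.
- rewrite -setXTT; apply: compact_setX => //.
  have := @tychonoff Q (fun=> K) (fun=> setT) (fun=> cK).
  by congr compact; apply/seteqP.
- move=> x y xy.
  have H (T : topologicalType) (f : W -> T) :
      hausdorff_space T -> continuous f -> f x = f y.
    move=> hT fc; apply: hT => A B Ax By.
    by have [z [Az Bz]] := xy _ _ (fc x A Ax) (fc y B By); exists (f z).
  apply: wreath_eqP => [q|]; first exact: H hK (@wreath_fst_continuous q).
  exact: H hQ wreath_snd_continuous.
move=> x _; apply/seteqP; split=> [y [C [Cx _ cC] Cy]|_ ->]; last first.
  exact: connected_component_refl.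
have H (T : topologicalType) (f : W -> T) :
    totally_disconnected [set: T] -> continuous f -> f y = f x.
  move=> tT fc; have : connected_component setT (f x) (f y).
    exists (f @` C); last by exists y.
    split=> //; apply: connected_continuous_connected cC _.
    exact: continuous_subspaceT.
  by rewrite tT.
apply: wreath_eqP => [q|]; first exact: H tK (@wreath_fst_continuous q).
exact: H tQ wreath_snd_continuous.
Qed.

Definition wreath_in (q : Q) (k : K) : W := (fun q' => if q' == q then k else 1, 1).

Lemma wreath_inM q : {morph wreath_in q : a b / a * b}.
Proof.
move=> a b; apply: wreath_eqP => [q'|] /=; last by rewrite mulg1.
by rewrite mulg1; case: eqP => // _; rewrite mulg1.
Qed.

Lemma wreath_in_continuous q : continuous (wreath_in q).
Proof.
apply: wreath_continuous => [q' x|x] /=.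
by case: eqP => _; [exact: cvg_id|exact: cvg_cst].
exact: cvg_cst.
Qed.

Lemma wreath_base_exp (w : W) n : w.2 = 1 -> (w ^+ n).2 = 1 /\
  forall q, (w ^+ n).1 q = w.1 q ^+ n.
Proof.
move=> w2; elim: n => [|n [IH1 IH2]]; first by [].
rewrite expgS; split=> [|q] /=. by rewrite w2 IH1 mulg1.
by rewrite w2 mulg1 IH2 expgS.
Qed.

(** An element of the base group is the product of its single-coordinate parts, split off one at a
    time along [enum Q]. *)
Lemma wreath_base_mem (N : openSubgroup W) (w : W) : w.2 = 1 ->
  (forall q, subg_set N (wreath_in q (w.1 q))) -> subg_set N w.
Proof.
move=> w2 Nw.
suff H s : uniq s -> subg_set N ((fun q => if q \in s then w.1 q else 1, 1) : W).
  rewrite (_ : w = (fun q => if q \in enum Q then w.1 q else 1, 1)).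
    by apply: H; exact: enum_uniq.
  by apply: wreath_eqP => //= q; rewrite mem_enum.
elim: s => [|q s IH] /=; first by move=> _; exact: subg1.
move=> /andP[qs us]; have := subgM (Nw q) (IH us).
congr subg_set; apply: wreath_eqP => /= [q'|]; last exact: mulg1.
rewrite mulg1 inE; case: eqP => [->|_] /=; first by rewrite (negPf qs) mulg1.
by rewrite mul1g.
Qed.

(** The power of exponent [#|Q|] falls into the base group; there a further [p]-power brings each
    coordinate into the preimage of [N], and the sum of the exponents [e q] serves all coordinates
    at once. *)
Lemma wreath_pro_p p : prime p -> p.-group [set: Q]%SET -> pro_p p K -> pro_p p W.
Proof.
move=> p_pr pQ pK; apply: pro_p_exponent => // [|N g nN].
  by apply: wreath_profinite; have [] := pK.
pose m := logn p #|Q|.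
have sndM : {morph (fun x : W => x.2) : a b / a * b} by [].
have h2 : (g ^+ (p ^ m)%N).2 = 1.
  rewrite (@morph_exp _ (disc Q) (fun x : W => x.2))//.
  by rewrite /m -cardsT -card_pgroup// expg_cardG ?inE.
have [e He] : exists e : Q -> nat, forall q k,
    subg_set N (wreath_in q (k ^+ (p ^ e q)%N)).
  suff /boolp.choice[e eP] : forall q, exists e : nat, forall k,
      subg_set N (wreath_in q (k ^+ (p ^ e)%N)) by exists e.
  move=> q; have [V VP] := preimage_openSubgroup N (@wreath_inM q)
    (@wreath_in_continuous q).
  by have [e eV] := pro_p_power_mem V p_pr pK; exists e => k; exact/VP.
exists (m + \sum_q e q)%N; rewrite expnD expgM.
have [h2' h1] := wreath_base_exp (p ^ \sum_q e q)%N h2.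
apply: wreath_base_mem => // q; rewrite h1 (bigD1 q)//= addnC expnD expgM.
exact: He.
Qed.
End Wreath.

(** * Labellings of the Cayley graph of a finite quotient *)

Lemma cyclic_pgroup (p M : nat) : prime p -> exists (C : finGroupType) (c : C),
  p.-group [set: C]%SET /\ #[c] = (p ^ M)%N.
Proof.
move=> p_pr; have pM : 0 < (p ^ M)%N by rewrite expn_gt0 prime_gt0.
exists ('I_((p ^ M).-1.+1) : finGroupType), (Zp1 : 'I_((p ^ M).-1.+1)).
rewrite /pgroup cardsT card_ord order_Zp1 prednK//; split=> //.
by rewrite pnatX pnat_id.
Qed.

Lemma quotient_map_continuous (G : topGroupType) (Q : finGroupType)
    (phi : G -> Q) : {morph phi : a b / a * b} -> nbhs 1 [set g | phi g = 1] ->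
  continuous (phi : G -> disc Q).
Proof.
move=> phiM phi1 g U Ug.
have nh : nbhs g [set h | phi (g^-1 * h) = 1].
  have := @mulgl_continuous G g^-1 g [set h | phi h = 1].
  by rewrite mulVg; apply.
apply: (@filterS _ (nbhs g) _ _ _ _ nh) => h /=.
rewrite phiM morph_inv// => /(canRL (mulVKg _)); rewrite mulg1 => ->.
exact: (nbhs_singleton Ug).
Qed.

Lemma continuous_kernel (G : topGroupType) (Q : finGroupType)
    (phi : G -> disc Q) : {morph phi : a b / a * b} -> continuous phi ->
  nbhs 1 [set g | phi g = 1].
Proof.
move=> phiM phic; have := phic 1 [set 1]; rewrite morph_one//; apply.
exact: discrete_set1.
Qed.

(* [F g q] is the label of the path [q -> q * phi g] of the Cayley graph of [Q]. *)
Definition cocycle (G K : topGroupType) (Q : finGroupType) (phi : G -> Q)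
    (F : G -> Q -> K) :=
  (forall g h q, F (g * h) q = F g q * F h (q * phi g)) /\
  forall q, continuous (F^~ q).

Section Free.
Context (p r : nat) (G : topGroupType) (x : 'I_r -> G).
Hypotheses (p_pr : prime p) (pG : pro_p p G) (xG : free_pro_p_basis p x).

Lemma free_lift (H : topGroupType) (y : 'I_r -> H) : pro_p p H ->
  exists f : G -> H,
    [/\ continuous f, {morph f : a b / a * b} & forall i, f (x i) = y i].
Proof. by move=> /(xG y)[f [? _]]; exists f. Qed.

Lemma free_unique (H : topGroupType) (f g : G -> H) : pro_p p H ->
  continuous f -> {morph f : a b / a * b} ->
  continuous g -> {morph g : a b / a * b} ->
  (forall i, f (x i) = g (x i)) -> f = g.
Proof.
move=> pH fc fM gc gM fg; have [h [_ hU]] := xG (fun i => f (x i)) pH.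
by rewrite -(hU f) ?(hU g)//; split.
Qed.

Section Cocycle.
Context (Q : finGroupType) (phi : G -> Q) (K : topGroupType).
Hypotheses (phiQ : quotient_map phi) (pK : pro_p p K).

Let phiM : {morph phi : a b / a * b}. Proof. by case: phiQ. Qed.
Let phic : continuous (phi : G -> disc Q).
Proof. by case: phiQ => *; apply: quotient_map_continuous. Qed.
Let pQ : p.-group [set: Q]%SET. Proof. exact: pro_p_quotient phiQ _. Qed.
Let pW : pro_p p (wreath K Q). Proof. exact: wreath_pro_p. Qed.

(** Lift the basis to the pairs [(l i, phi (x i))] of the wreath product. By uniqueness the second
    component of the lift is [phi]; the first one is [F]. *)
Lemma cocycle_exists (l : 'I_r -> Q -> K) : exists2 F : G -> Q -> K,
  cocycle phi F & forall i q, F (x i) q = l i q.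
Proof.
have [f [fc fM fx]] := free_lift (fun i => (l i, phi (x i)) : wreath K Q) pW.
have f2 : (fun g => (f g).2) = phi.
  apply: (@free_unique (disc Q)) => //.
  - exact: disc_pro_p.
  - move=> g; apply: (@continuous_comp _ (wreath K Q) (disc Q) f (fun w => w.2)).
      exact: fc.
    exact: wreath_snd_continuous.
  - by move=> a b; rewrite fM.
  - by move=> i; rewrite fx.
exists (fun g q => (f g).1 q); last by move=> i q; rewrite fx.
split=> [g h q|q g]; first by rewrite fM -[phi]f2.
apply: (@continuous_comp _ (wreath K Q) K f (fun w => w.1 q)).
  exact: fc.
exact: wreath_fst_continuous.
Qed.

(** Paired with [phi], a cocycle is a continuous homomorphism into the wreath product. *)
Lemma cocycle_unique (F F' : G -> Q -> K) : cocycle phi F -> cocycle phi F' ->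
  (forall i q, F (x i) q = F' (x i) q) -> forall g q, F g q = F' g q.
Proof.
move=> [FM Fc] [F'M F'c] FF' g q.
pose f (F : G -> Q -> K) g : wreath K Q := (F g, phi g).
suff : f F = f F' by move=> /(congr1 (fun f => (f g).1 q)).
have fc E : (forall q, continuous (E^~ q)) -> continuous (f E).
  by move=> Ec; apply: wreath_continuous.
have fM E : (forall g h q, E (g * h) q = E g q * E h (q * phi g)) ->
    {morph f E : a b / a * b}.
  by move=> EM a b; apply: wreath_eqP => [q'|] /=; rewrite ?EM// phiM.
apply: free_unique => //; [exact: fc|exact: fM|exact: fc|exact: fM|].
by move=> i; apply: wreath_eqP => //= q'; rewrite FF'.
Qed.

End Cocycle.
End Free.

Lemma cocycle1 (G K : topGroupType) (Q : finGroupType) (phi : G -> Q)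
    (F : G -> Q -> K) q : {morph phi : a b / a * b} -> cocycle phi F -> F 1 q = 1.
Proof.
move=> phiM [FM _]; apply: (mulgI (F 1 q)).
by have := FM 1 1 q; rewrite (morph_one phiM) !mulg1.
Qed.

(** The exponent counts the visits to 1 of the path that starts at [q] and follows [g] for [n]
    steps. *)
Lemma cocycle_exp (G K : topGroupType) (Q : finGroupType) (phi : G -> Q)
    (F : G -> Q -> K) (g : G) (d : K) : {morph phi : a b / a * b} -> cocycle phi F ->
  (forall q, F g q = d ^+ (q == 1)) -> forall n q,
  F (g ^+ n) q = d ^+ (\sum_(j < n) (q * phi g ^+ j == 1)%g)%N.
Proof.
move=> phiM Fc Fg; have [FM _] := Fc; elim=> [|n IH] q.
  by rewrite big_ord0 expg0 (cocycle1 q phiM Fc).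
rewrite expgS FM Fg IH big_ord_recl /= expg0 mulg1 expgD; congr (_ * _ ^+ _).
by apply: eq_bigr => j _; rewrite expgS mulgA.
Qed.

Lemma cocycle_exp_const (G K : topGroupType) (Q : finGroupType) (phi : G -> Q)
    (F : G -> Q -> K) (g : G) (d : K) q0 :
  {morph phi : a b / a * b} -> cocycle phi F ->
  (forall j, F g (q0 * phi g ^+ j) = d) -> forall n, F (g ^+ n) q0 = d ^+ n.
Proof.
move=> phiM Fc Fg; have [FM _] := Fc; elim=> [|n IH].
  by rewrite !expg0 (cocycle1 q0 phiM Fc).
by rewrite expgSr FM IH (morph_exp n phiM) Fg -expgSr.
Qed.

(** * Triviality of the centralizers of open subgroups *)

Lemma count_power_one (Q : finGroupType) (h : Q) n : 0 < n ->
  0 < (\sum_(j < n) (h ^+ j == 1)%g)%N <= n.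
Proof.
case: n => // n _; rewrite big_ord_recl expg0 eqxx /= add1n ltnS.
rewrite -[leqRHS](@card_ord n) -sum1_card; apply: leq_sum => j _.
by case: (_ == _).
Qed.

(** The crude bound [s <= n < p ^ n] is enough, so cyclic groups of order [p ^ n] detect all counts
    up to [n]. *)
Lemma expg_order_pow_neq1 (p n s : nat) (C : finGroupType) (c : C) :
  prime p -> #[c] = (p ^ n)%N -> 0 < s <= n -> c ^+ s <> 1.
Proof.
move=> p_pr cn /andP[s0 sn] /eqP; rewrite -order_dvdn cn => /(dvdn_leq s0).
by rewrite leqNgt (leq_ltn_trans sn)// ltn_expl// prime_gt1.
Qed.

Lemma image_openSubgroup (G : topGroupType) (U : openSubgroup G)
    (O : openSubgroup U) : exists O' : openSubgroup G,
  forall g, subg_set O' g <-> exists2 u : U, subg_set O u & val u = g.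
Proof.
pose S := [set g : G | exists2 u : U, subg_set O u & val u = g].
have SM x y : S x -> S y -> S (x * y).
  by move=> [u Ou <-] [v Ov <-]; exists (u * v) => //; exact: subgM.
have SV x : S x -> S x^-1.
  by move=> [u Ou <-]; exists u^-1 => //; exact: subgV.
have S1 : S 1 by exists 1 => //; exact: subg1.
have nS : nbhs 1 S.
  have : nbhs (1 : U) O.
    by apply: open_nbhs_nbhs; split; [exact: subg_open|exact: subg1].
  move=> [V [[B oB <-] B1] VO].
  have : nbhs 1 (B `&` U).
    apply: open_nbhs_nbhs; split; first by apply: openI => //; exact: subg_open.
    by split=> //; exact: subg1.
  apply: filterS => g [Bg Ug]; exists (exist _ g (mem_set Ug)) => //.
  exact: VO.
by exists (@OpenSubgroup G S (subgroup_nbhs1_open SM nS) S1 SM SV).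
Qed.

Lemma quotient_card_exp (G : topGroupType) (Q : finGroupType) (phi : G -> Q) g :
  {morph phi : a b / a * b} -> phi (g ^+ #|Q|) = 1.
Proof. by move=> phiM; rewrite morph_exp// -cardsT expg_cardG ?inE. Qed.

Section Rigidity.
Context (p r : nat) (G : topGroupType) (x : 'I_r -> G).
Hypotheses (p_pr : prime p) (pG : pro_p p G) (xG : free_pro_p_basis p x).
Context (i0 i1 : 'I_r).
Hypothesis i01 : i1 != i0.

Let cG : compact [set: G]. Proof. by case: pG => -[]. Qed.

Lemma exists_character M : exists (C : finGroupType) (c : C) (f : G -> disc C),
  [/\ #[c] = (p ^ M)%N, {morph f : g h / g * h}, continuous f, f (x i0) = c &
      f (x i1) = 1].
Proof.
have [C [c [pC cM]]] := cyclic_pgroup M p_pr.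
have [f [fc fM fx]] := free_lift xG (H := disc C)
  (fun i => if i == i0 then c else 1)
  (disc_pro_p p_pr pC).
by exists C, c, f; rewrite !fx eqxx (negPf i01).
Qed.

(** Only the [x i] edge leaving 1 is labelled by [c]. The closed path of [x i ^+ n] at 1 has a
    non-trivial label, but the one at [phi g] avoids 1 when [phi g] is not a power of [phi (x i)].
    Computing the label of [g * x i ^+ n] in both orders equates the two. *)
Lemma centralizer_mod (i : 'I_r) (k : nat) (g : G) (Q : finGroupType)
    (phi : G -> Q) :
  0 < k -> quotient_map phi -> commute g (x i ^+ k) ->
  phi g \in <[phi (x i)]>%g.
Proof.
move=> k0 phiQ gk; have [phiM _ _] := phiQ.
pose n := (k * #[phi (x i)])%N.
have n0 : 0 < n by rewrite muln_gt0 k0 order_gt0.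
have gn : commute g (x i ^+ n) by rewrite expgM; exact: commuteX.
have phin : phi (x i ^+ n) = 1.
  by rewrite morph_exp// /n mulnC expgM expg_order expg1n.
have [C [c [pC cn]]] := cyclic_pgroup n p_pr.
have [F Fc Fx] := cocycle_exists p_pr pG xG phiQ (disc_pro_p p_pr pC)
  (fun i' q => if i' == i then c ^+ (q == 1) else 1).
have FX := cocycle_exp phiM Fc (d := (c : disc C)) (g := x i).
have {}FX : forall q, F (x i ^+ n) q =
    (c : disc C) ^+ (\sum_(j < n) (q * phi (x i) ^+ j == 1)%g)%N.
  by apply: FX => q; rewrite Fx eqxx.
apply: contrapT => ng.
have FXg : F (x i ^+ n) (phi g) = 1.
  rewrite FX big1// => j _; case: eqP => // /(canRL (mulgK _)) E.
  by case: ng; rewrite E mul1g groupV mem_cycle.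
have [FM _] := Fc.
have := FM g (x i ^+ n) 1; rewrite gn FM phin mulg1 mul1g FXg mulg1.
move=> /(canRL (mulgK _)); rewrite mulgV FX.
under eq_bigr => j _ do rewrite mul1g.
exact: (expg_order_pow_neq1 p_pr cn (count_power_one _ n0)).
Qed.

(** In finite quotients [g] is a power both of [x i0] and of [x i1]. The character [f] kills [x i1],
    so the exponent [j] of [x i0] is divisible by the order of [c], which is that of [Q]. *)
Lemma centralizer_trivial (k : nat) (g : G) : 0 < k ->
  commute g (x i0 ^+ k) -> commute g (x i1 ^+ k) -> g = 1.
Proof.
move=> k0 g0 g1; apply: contrapT => /(profinite_separation pG.1)[W nWg].
have [Q [phi [phiQ phiW]]] := exists_quotient_map W cG.
have [phiM _ phi1] := phiQ.
have pQ := pro_p_quotient pG phiQ p_pr.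
have [C [c [f [cM fM fc f0 f1]]]] := exists_character (logn p #|Q|).
have [N1 _ N1P] := kernel_openSubgroup phiM phi1.
have [N2 _ N2P] := kernel_openSubgroup fM (continuous_kernel fM fc).
(* Both [phi] and [f] factor through [phi'], so the same exponent works for both. *)
have [Q' [phi' [phi'Q phi'N]]] := exists_quotient_map (subgI N1 N2) cG.
have [phi'M _ _] := phi'Q.
have H i : commute g (x i ^+ k) ->
    exists j, phi g = phi (x i) ^+ j /\ f g = f (x i) ^+ j.
  move=> /(centralizer_mod k0 phi'Q)/cycleP[j].
  rewrite -morph_exp// => E; exists j.
  have : phi' (g * (x i ^+ j)^-1) = 1 by rewrite phi'M E -phi'M mulgV morph_one.
  move=> /phi'N/(_ 1); rewrite mul1g invg1 mulg1 => -[/N1P H1 /N2P H2].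
  move: H1 H2; rewrite phiM fM (morph_inv phiM) (morph_inv fM).
  rewrite (morph_exp _ phiM) (morph_exp _ fM) => H1 H2.
  by split; [move: H1|move: H2]; move=> /(canRL (mulgVK _)); rewrite mul1g.
have [j [phij fj]] := H _ g0; have [j' [_]] := H _ g1.
rewrite f1 expg1n fj f0 => cj.
have /dvdnP[m jm] : (p ^ logn p #|Q|)%N %| j.
  by rewrite -cM order_dvdn; apply/eqP.
apply: nWg; have /phiW/(_ 1) : phi g = 1.
  rewrite phij jm mulnC expgM -cardsT -(card_pgroup pQ).
  by rewrite expg_cardG ?inE// expg1n.
by rewrite mul1g invg1 mulg1.
Qed.

(** If [a] fixes both [n] and [u * n * u^-1], then [u^-1 * a u] commutes with [n]; take for [n]
    powers of [x i0] and [x i1] in the core of [W']. *)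
Lemma TAut_eq (U : openSubgroup G) : TAut U = [set 1].
Proof.
apply/seteqP; split=> [a [W aW]|_ ->]; last by exists (subgT U).
apply: topIsoP => u /=.
have [W' W'P] := image_openSubgroup W.
have [Q [phi [phiQ phiW]]] := exists_quotient_map W' cG.
have [phiM _ _] := phiQ.
have fixa (n : G) : phi n = 1 -> exists2 w : U, val w = n & a w = w.
  move=> /phiW/(_ 1); rewrite mul1g invg1 mulg1 => /W'P[w Ww wn].
  by exists w => //; exact: aW.
have comm (n : G) : phi n = 1 -> commute (val (u^-1 * a u)) n.
  move=> n1; have [w wn aw] := fixa n n1.
  have [v vn av] : exists2 v : U, val v = val u * n * (val u)^-1 & a v = v.
    by apply: fixa; rewrite !phiM n1 mulg1 -phiM mulgV morph_one.
  have E : v = u * w * u^-1 by apply: val_inj; rewrite vn -wn.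
  have : a v = a u * w * (a u)^-1 by rewrite E !isoM aw (morph_inv (@isoM _ _ a)).
  rewrite av E => /esym H.
  have : (u^-1 * a u) * w = w * (u^-1 * a u).
    by rewrite -mulgA (canRL (mulgVK _) H) !mulgA mulVg mul1g.
  by move=> /(congr1 val); rewrite /= wn.
have phik (g : G) := quotient_card_exp g phiM.
have Q0 : 0 < #|Q| by rewrite -cardsT cardG_gt0.
have := centralizer_trivial Q0 (comm _ (phik _)) (comm _ (phik _)).
move=> au; have : u^-1 * a u = 1 by apply: val_inj.
by move=> /(canRL (mulVKg _)); rewrite mulg1.
Qed.

Lemma TAut_closed (U : openSubgroup G) : closed (TAut U).
Proof.
rewrite TAut_eq -openC openE => c c1.
(* Neighborhoods of [c] are cosets [c * autA O], and [c * d = 1] means that [d] is the inverse of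
   [c]. *)
have [u cu] : exists u, iso_inv c u <> u.
  apply: contrapT => /forallNP cu; apply: c1 => /=; apply: topIsoP => u.
  by have := cu u; rewrite not_notE => E; rewrite -{1}E isoKV.
have [||W nW] := @profinite_separation G (val (u^-1 * iso_inv c u)).
- exact: pG.1.
- move=> E; apply: cu; have : u^-1 * iso_inv c u = 1 by apply: val_inj.
  by move=> /(canRL (mulVKg _)); rewrite mulg1.
have [O OP] := preimage_openSubgroup (f := val : U -> G) W (fun _ _ => erefl)
  (@subg_val_continuous _ _).
apply/nbhs_autE; exists O => _ [d dO <-] cd1; apply: nW.
have /OP := dO u; congr (subg_set W (val (_ * _))).
by apply: (can_inj (isoK c)); rewrite isoKV -[LHS]/((c * d) u) cd1.
Qed.

End Rigidity.

(** * Automorphisms twisted along one edge *)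

Lemma cocycle_comp (G K L : topGroupType) (Q : finGroupType) (phi : G -> Q)
    (F : G -> Q -> K) (f : K -> L) : cocycle phi F ->
  {morph f : a b / a * b} -> continuous f -> cocycle phi (fun g q => f (F g q)).
Proof.
move=> [FM Fc] fM fc; split=> [g h q|q g]; first by rewrite FM fM.
by apply: (@continuous_comp _ K L (F^~ q) f); [exact: Fc|exact: fc].
Qed.

Section Twist.
Context (p r : nat) (G : topGroupType) (x : 'I_r -> G).
Hypotheses (p_pr : prime p) (pG : pro_p p G) (xG : free_pro_p_basis p x).
Context (i0 i1 : 'I_r) (Q : finGroupType) (phi : G -> Q).
Hypotheses (i01 : i1 != i0) (phiQ : quotient_map phi).

Let phiM : {morph phi : a b / a * b}. Proof. by case: phiQ. Qed.

(** With the labels [x i] on all edges the cocycle would be [F g q = g]; just one edge is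
    changed. *)
Definition twist (z : G) (F : G -> Q -> G) := cocycle phi F /\
  forall i q, F (x i) q = (if (i == i1) && (q == 1) then z else 1) * x i.

Lemma twist_exists z : exists F, twist z F.
Proof.
have [F Fc Fx] := cocycle_exists p_pr pG xG phiQ pG
  (fun i q => (if (i == i1) && (q == 1) then z else 1) * x i).
by exists F.
Qed.

Lemma twist_exp_fix z F n q : twist z F -> F (x i0 ^+ n) q = x i0 ^+ n.
Proof.
move=> [Fc Fx]; apply: (cocycle_exp_const phiM Fc) => j.
by rewrite Fx eq_sym (negPf i01) mul1g.
Qed.

(** Modulo [psi] the change of label disappears. With [psi = phi] this shows that [F] preserves the
    kernel of [phi]; with a finer [psi], that [F] is close to the identity. *)
Lemma twist_mod z F (Q' : finGroupType) (psi : G -> Q') : twist z F ->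
  quotient_map psi -> psi z = 1 -> forall g q, psi (F g q) = psi g.
Proof.
move=> [Fc Fx] psiQ psiz; have [psiM psiS psi1] := psiQ.
have psic := quotient_map_continuous psiM psi1.
apply: (cocycle_unique p_pr pG xG phiQ (K := disc Q')).
- by apply: disc_pro_p => //; exact: pro_p_quotient psiQ _.
- exact: cocycle_comp.
- by split=> [g h q|q]; [exact: psiM|exact: psic].
- by move=> i q; rewrite Fx psiM; case: ifP; rewrite ?psiz ?(morph_one psiM) mul1g.
Qed.

(* [g |-> F' (F g q) q] is again a cocycle, with the labels of the identity. *)
Lemma twist_inv z z' F F' : twist z F -> twist z' F' -> z * z' = 1 ->
  phi z = 1 -> F' z 1 = z -> forall g q, F' (F g q) q = g.
Proof.
move=> zF z'F' zz' phiz F'z.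
have phiF := twist_mod zF phiQ phiz.
have [[FM Fc] Fx] := zF; have [[F'M F'c] F'x] := z'F'.
apply: (cocycle_unique p_pr pG xG phiQ pG).
- split=> [g h q|q g]; first by rewrite FM F'M phiF.
  by apply: (@continuous_comp _ G G (F^~ q) (F'^~ q)); [exact: Fc|exact: F'c].
- by split=> // q g; exact: cvg_id.
move=> i q; rewrite Fx; case: ifP => [/andP[/eqP-> /eqP->]|E].
  (* On the changed edge [F'] fixes [z], which is a closed path at 1, and then contributes [z']. *)
  by rewrite F'M F'z phiz mulg1 F'x !eqxx /= mulgA zz' mul1g.
by rewrite mul1g F'x E mul1g.
Qed.

(** Elements of [N] are closed paths at 1, on which the cocycle rule is multiplicativity. *)
Lemma twist_topIso z F F' (N : openSubgroup G) :
  (forall g, subg_set N g <-> phi g = 1) -> twist z F -> twist z^-1 F' ->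
  phi z = 1 -> F z 1 = z -> F' z 1 = z ->
  exists c : topIso N N, forall n, val (c n) = F (val n) 1.
Proof.
move=> NP zF z'F' phiz Fz F'z.
have phiz' : phi z^-1 = 1 by rewrite (morph_inv phiM) phiz invg1.
have Fz' : F z^-1 1 = z^-1.
  have [Fc _] := zF; have [FM _] := Fc; apply: (mulgI z).
  by have := FM z z^-1 1; rewrite Fz phiz mulg1 mulgV (cocycle1 1 phiM Fc) => <-.
pose res w E (wE : twist w E) (phiw : phi w = 1) (n : N) : N :=
  exist _ (E (val n) 1) (mem_set (iffRL (NP _) (eq_trans
    (twist_mod wE phiQ phiw _ _) (iffLR (NP _) (set_mem (valP n)))))).
have resM w E wE phiw : {morph @res w E wE phiw : a b / a * b}.
  move=> a b; apply: val_inj => /=; have [[EM _] _] := wE.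
  by rewrite EM (iffLR (NP _) (set_mem (valP a))) mulg1.
have resc w E wE phiw : continuous (@res w E wE phiw).
  apply: (@continuous_comp_initial N _ G set_val) => n.
  apply: (@continuous_comp _ _ _ (val : N -> G) (E^~ 1)).
    exact: subg_val_continuous.
  by case: wE => -[_ Ec] _; exact: Ec.
have resK : cancel (res _ _ zF phiz) (res _ _ z'F' phiz').
  by move=> n; apply: val_inj; apply: (twist_inv zF z'F'); rewrite ?mulgV.
have resK' : cancel (res _ _ z'F' phiz') (res _ _ zF phiz).
  by move=> n; apply: val_inj; apply: (twist_inv z'F' zF); rewrite ?mulVg.
by exists (TopIso (resM _ _ zF phiz) resK resK' (resc _ _ zF phiz)
  (resc _ _ z'F' phiz')).
Qed.

End Twist.

(** * Failure of Aut-stability *)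

Lemma not_Aut_stable (p r : nat) (G : topGroupType) (x : 'I_r -> G)
    (i0 i1 : 'I_r) (U : openSubgroup G) :
  prime p -> pro_p p G -> free_pro_p_basis p x -> i1 != i0 -> ~ Aut_stable U.
Proof.
move=> p_pr pG xG i01 stU; have cG : compact [set: G] by case: pG => -[].
have [Q0 [phi0 [[phi0M _ phi01] phi0U]]] := exists_quotient_map U cG.
pose s0 := #|Q0|; pose u0 := x i0 ^+ s0.
have s00 : 0 < s0 by rewrite /s0 -cardsT cardG_gt0.
have Uu0 : subg_set U u0.
  have /phi0U/(_ 1) := quotient_card_exp (x i0) phi0M.
  by rewrite mul1g invg1 mulg1.
(* The order [p ^ s0] exceeds [s0], so [f0] does not kill [u0], while it kills [x i1]. *)
have [C0 [c0 [f0 [c0M f0M f0c f0x0 f0x1]]]] := exists_character p_pr xG i01 s0.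
have [N1 _ N1P] := kernel_openSubgroup phi0M phi01.
have [N2 _ N2P] := kernel_openSubgroup f0M (continuous_kernel f0M f0c).
have [Q [phi [phiQ phiN]]] := exists_quotient_map (subgI N1 N2) cG.
have [phiM _ phi1] := phiQ.
have [N _ NP] := kernel_openSubgroup phiM phi1.
have NI g : phi g = 1 -> phi0 g = 1 /\ f0 g = 1.
  by move=> /phiN/(_ 1); rewrite mul1g invg1 mulg1 => -[/N1P ? /N2P].
have NU : N `<=` U.
  by move=> g /NP/NI[/phi0U/(_ 1) + _]; rewrite mul1g invg1 mulg1.
(* The path following [x i1] from [phi u0^-1] never meets 1, so it avoids the twisted edge. *)
have phiu0 j : phi u0^-1 * phi (x i1) ^+ j != 1.
  apply/eqP; rewrite -(morph_exp _ phiM) -phiM => /NI[_].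
  rewrite f0M (morph_exp _ f0M) f0x1 expg1n mulg1 (morph_inv f0M).
  rewrite (morph_exp _ f0M) f0x0 => cV.
  have : c0 ^+ s0 = 1 by rewrite -[LHS]invgK [X in X^-1]cV invg1.
  by apply: (expg_order_pow_neq1 p_pr c0M); rewrite s00 leqnn.
have [_ oN] := stU N NU.
have one_stab : uAut_stab U N (@rho G N 1).
  exists 1; first by apply/seteqP; split=> [_ [g ? <-]|g ?] //; exists g.
  apply/eqmodP/asboolP; exists N; split=> //.
(* Stability would make every automorphism of [N] in [autA O] agree with one of [U] on an open
   subgroup. *)
have /nbhs_autE[O ON] : nbhs (1 : Aut N) (@rho G N @^-1` uAut_stab U N).
  by apply: open_nbhs_nbhs.
have [O' O'P] := image_openSubgroup O.
have [Q1 [phi1' [phi1Q phi1O]]] := exists_quotient_map O' cG.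
have {}phi1O g : phi1' g = 1 -> exists2 u : N, subg_set O u & val u = g.
  by move=> /phi1O/(_ 1); rewrite mul1g invg1 mulg1 => /O'P.
have [phi1M _ _] := phi1Q.
(* This power of [x i0] dies in [Q1], hence lies in [O'], which puts the twist by [z] in
   [autA O]. *)
pose s := #|Q1|; pose z := x i0 ^+ s.
have s_gt0 : 0 < s by rewrite /s -cardsT cardG_gt0.
have phi1z : phi1' z = 1 by exact: quotient_card_exp.
have phiz : phi z = 1.
  by have [u _ <-] := phi1O _ phi1z; apply/NP/set_mem/(valP u).
have [F zF] := twist_exists p_pr pG xG i1 phiQ z.
have [F' zF'] := twist_exists p_pr pG xG i1 phiQ z^-1.
have [c cE] := twist_topIso p_pr pG xG phiQ NP zF zF' phiz
  (twist_exp_fix i01 phiQ _ _ zF) (twist_exp_fix i01 phiQ _ _ zF').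
have Oc : autA O c.
  move=> g; have [|u Ou uE] := phi1O (val (g^-1 * c g)).
    rewrite /= phi1M (morph_inv phi1M) -[sval (c g)]/(val (c g)) cE.
    by rewrite (twist_mod p_pr pG xG phiQ zF phi1Q phi1z) mulVg.
  by rewrite -(val_inj uE).
have [|al _ rho_al] := ON c; first by exists c => //; rewrite mul1g.
have [W [WU WN alc]] : vAut_equiv (VAut al) (VAut c).
  by move: rho_al => /eqmodP/asboolP.
have [Q2 [phi2 [phi2Q phi2W]]] := exists_quotient_map W cG.
have [phi2M _ _] := phi2Q.
pose k := #|Q2|.
have k_gt0 : 0 < k by rewrite /k -cardsT cardG_gt0.
have phi2b : phi2 (x i1 ^+ k) = 1 by exact: quotient_card_exp.
have Wb : subg_set W (x i1 ^+ k).
  by move/phi2W/(_ 1) : phi2b; rewrite mul1g invg1 mulg1.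
(* [x i1 ^+ k] lies in the core of [W], so [W] also contains this conjugate. *)
pose n := u0^-1 * x i1 ^+ k * u0.
have Wn : subg_set W n.
  by move/phi2W/(_ u0^-1) : phi2b; rewrite invgK.
have alE (g : G) (Wg : subg_set W g) :
    exists2 v : U, val v = g & val (al v) = F g 1.
  exists (exist _ g (mem_set (WU _ Wg))) => //.
  rewrite (alc _ (exist _ g (mem_set (WN _ Wg))))//=.
  by rewrite -[sval (c _)]/(val (c _)) cE.
have [vb vbE alb] := alE _ Wb; have [vn vnE aln] := alE _ Wn.
pose vu : U := exist _ u0 (mem_set Uu0).
have vbn : vb = vu * vn * vu^-1.
  apply: val_inj; rewrite /= -[sval vn]/(val vn) vnE -[LHS]/(val vb) vbE.
  by rewrite !mulgA mulgV mul1g mulgK.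
(* Here [al] is evaluated at [u0], which [c] need not allow. *)
have Fconj : F (x i1 ^+ k) 1 = val (al vu) * F n 1 * (val (al vu))^-1.
  by rewrite -aln -alb vbn !isoM (morph_inv (@isoM _ _ al)).
(* The path of [x i1 ^+ k] at 1 uses the twisted edge between 1 and [k] times, each adding [s] to
   the exponent of [cc]; order [p ^ (s * k)] detects the total. *)
have [C [cc [f [ccM fM fc fx0 fx1]]]] := exists_character p_pr xG i01 (s * k)%N.
have [Fc Fx] := zF; have [FM _] := Fc.
(* The middle part of the path of [n] starts at [phi u0^-1], so [F n 1] is a conjugate of
   [x i1 ^+ k]. *)
have fn : f (F n 1) = 1.
  have phib : phi (x i1 ^+ k) = 1 by exact/NP/WN.
  have Fb : F (x i1 ^+ k) (phi u0^-1) = x i1 ^+ k.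
    apply: (cocycle_exp_const phiM Fc) => j.
    by rewrite Fx (negPf (phiu0 j)) andbF mul1g.
  rewrite /n 2!FM phiM phib mulg1 mul1g Fb !fM (morph_exp _ fM) fx1 expg1n mulg1.
  rewrite -fM; have := FM u0^-1 u0 1; rewrite mul1g => <-.
  by rewrite mulVg (cocycle1 1 phiM Fc) (morph_one fM).
have fb : f (F (x i1 ^+ k) 1) = 1.
  by rewrite Fconj !fM fn mulg1 -fM mulgV (morph_one fM).
have fFc := cocycle_comp Fc fM fc.
have := cocycle_exp phiM fFc (g := x i1) (d := (cc : disc C) ^+ s) _ k 1.
rewrite fb => /(_ _)/esym H.
have {H} : (cc : disc C) ^+ s ^+ (\sum_(j < k) (phi (x i1) ^+ j == 1)%g)%N = 1.
  rewrite -[RHS]H => [|q].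
    by congr (_ ^+ _); apply: eq_bigr => j _; rewrite mul1g.
  rewrite Fx eqxx fM fx1 mulg1; case: (q == 1) => /=.
    by rewrite (morph_exp _ fM) fx0.
  by rewrite (morph_one fM).
rewrite -expgM; apply: (expg_order_pow_neq1 p_pr ccM).
have /andP[c1 c2] := count_power_one (phi (x i1)) k_gt0.
by rewrite muln_gt0 s_gt0 c1 leq_mul2l c2 orbT.
Qed.

Theorem proposition8p9 (p r : nat) (G : topGroupType) :
  prime p -> 1 < r -> free_pro_p p r G -> Aut1 G /\ ~ Aut2 G.
Proof.
move=> p_pr r1 [pG [x xG]].
have i01 : Ordinal r1 != Ordinal (ltnW r1) by [].
split=> [U|[_ [U]]].
  exact: (TAut_closed p_pr pG xG (i0 := Ordinal (ltnW r1)) (i1 := Ordinal r1)).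
exact: not_Aut_stable p_pr pG xG i01.
Qed.
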